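(* Let $Q$ be a quiver with no oriented cycles and let $\theta\in\mathbb{Z}^{Q_0}$ be a weight. Let $F=\mathbb{C}[t_m\mid m\in\nabla(Q,\theta)\cap\mathbb{Z}^{Q_1}]$ be the polynomial ring with one variable for each lattice point of $\nabla(Q,\theta)$, with the standard grading, and let $\varphi:F\to\mathcal{A}(Q,\theta)$ be the $\mathbb{C}$-algebra surjection $t_m\mapsto x^m$. Then the ideal $\ker(\varphi)$ is generated by elements of degree at most $3$.
   Context: A quiver $Q$ is a finite directed graph with vertex set $Q_0$ and arrow set $Q_1$ (multiple arrows allowed); an arrow $a$ goes from $a^-$ to $a^+$. For a weight $\theta\in\mathbb{Z}^{Q_0}$ the quiver polyhedron is $\nabla(Q,\theta)=\{x\in\mathbb{R}^{Q_1}\mid x\ge 0,\ \forall v\in Q_0:\ \theta(v)=\sum_{a^+=v}x(a)-\sum_{a^-=v}x(a)\}$ (a polytope when $Q$ has no oriented cycles). In the polynomial ring $\mathbb{C}[x(a)\mid a\in Q_1]$ write $x^m=\prod_{a\in Q_1}x(a)^{m(a)}$ for $m\in\mathbb{Z}_{\ge 0}^{Q_1}$, and let $\mathcal{A}(Q,\theta)$ be the subalgebra generated by the $x^m$ with $m\in\nabla(Q,\theta)\cap\mathbb{Z}^{Q_1}$ (the homogeneous coordinate ring of the toric quiver variety in its natural embedding into projective space). *)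

(* Defs.v *)
From HB Require Import structures.
From mathcomp Require Import all_boot all_order all_algebra.
From mathcomp Require Import complex.
From mathcomp Require Import Rstruct.
From mathcomp Require Import mpoly.

Set Implicit Arguments.
Unset Strict Implicit.
Unset Printing Implicit Defensive.

Import Order.TTheory GRing.Theory Num.Theory.
Local Open Scope ring_scope.

Definition CC : fieldType := (Rdefinitions.R)[i].

(* A quiver with vertex set 'I_nv and arrow set 'I_na; arrow a goes from
   src a (= a^-) to tgt a (= a^+). *)

Definition oriented_cycle (nv na : nat) (src tgt : 'I_na -> 'I_nv)
    (c : seq 'I_na) : bool :=
  if c is a :: c' then
    path (fun x y => tgt x == src y) a c' && (tgt (last a c') == src a)
  else false.

Definition acyclic_quiver (nv na : nat) (src tgt : 'I_na -> 'I_nv) : Prop :=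
  forall c : seq 'I_na, ~~ oriented_cycle src tgt c.

(* m : 'X_{1..na} (a vector of nonnegative integers indexed by arrows) is a
   lattice point of the quiver polyhedron nabla(Q, theta). *)
Definition quiver_lattice_point (nv na : nat) (src tgt : 'I_na -> 'I_nv)
    (theta : 'I_nv -> int) (m : 'X_{1.. na}) : Prop :=
  forall v : 'I_nv,
    theta v = (\sum_(a < na | tgt a == v) ((m a)%:Z))
              - (\sum_(a < na | src a == v) ((m a)%:Z)).

Definition quiver_phi (na N : nat) (e : 'I_N -> 'X_{1.. na})
    (p : {mpoly CC[N]}) : {mpoly CC[na]} :=
  p \mPo [tuple 'X_[e i] | i < N].

Definition in_ideal_gen_by_deg_le (N : nat) (K : {mpoly CC[N]} -> Prop)
    (d : nat) (f : {mpoly CC[N]}) : Prop :=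
  exists s : seq ({mpoly CC[N]} * {mpoly CC[N]}),
    (forall hg, hg \in s -> K hg.2 /\ (msize hg.2 <= d.+1)%N) /\
    f = \sum_(hg <- s) hg.1 * hg.2.

Notation arrow_vec na := ('X_{1.. na}) (only parsing).

(* Main.v *)
Require Import Defs.
From HB Require Import structures.
From mathcomp Require Import all_boot all_order all_algebra.
From mathcomp Require Import complex Rstruct mpoly.
From mathcomp Require Import zify ring.

Set Implicit Arguments.
Unset Strict Implicit.
Unset Printing Implicit Defensive.

Import Order.TTheory GRing.Theory Num.Theory.
Local Open Scope ring_scope.

(** Decompositions [S = x_1 + ... + x_k] into lattice points are to be connected
    by steps that replace at most three summands. Given another decomposition
    containing [y], one makes [y] appear among the summands and recurses on [k].
    To this end [x_1] is moved towards [y] one arrow at a time. The moved vector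
    [z] is a flow up to a source and a sink, and a second summand [w] carries the
    opposite defect, so [z + w] still splits into two lattice points, any two
    splittings differing by a step on two summands. If the next arrow has to be
    taken from a third summand [d], then [w + d] minus this arrow is split anew
    into a lattice point and a vector with the opposite defect; only
    [z, w, d] are affected. Both splittings rest on halving: an integral flow [H]
    of weight [2 theta], up to one source and one sink, contains an integral flow
    of weight [theta], found by peeling off arrows along a trail.

    Decompositions of different lengths only occur for [theta = 0], where
    acyclicity leaves the zero flow alone and the kernel is generated by
    [t_0 - 1]. *)

(** * Unit steps and distance between exponent vectors *)

Section Multinomials.

Variable n : nat.
Implicit Types (m y z : 'X_{1..n}) (a : 'I_n).

(* Multinomial subtraction is truncated, so this is the l1 distance. *)
Definition mnm_dist y z : nat := (mdeg (y - z)%MM + mdeg (z - y)%MM)%N.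

Lemma mnm_distUl y z a : (z a <= y a)%N ->
  mnm_dist (y + U_(a))%MM z = (mnm_dist y z).+1.
Proof.
move=> le; rewrite /mnm_dist.
have -> : (y + U_(a) - z = y - z + U_(a))%MM.
  apply/mnmP => b; rewrite !(mnmDE, mnmBE) mnm1E.
  by case: eqP => [<-|_]; lia.
have -> : (z - (y + U_(a)) = z - y)%MM.
  apply/mnmP => b; rewrite !(mnmDE, mnmBE) mnm1E.
  by case: eqP => [<-|_]; lia.
by rewrite mdegD mdeg1 addn1.
Qed.

Lemma mnm_distUr y z a : (y a < z a)%N ->
  mnm_dist y z = (mnm_dist (y + U_(a))%MM z).+1.
Proof.
move=> lt; rewrite /mnm_dist.
have -> : (y + U_(a) - z = y - z)%MM.
  apply/mnmP => b; rewrite !(mnmDE, mnmBE) mnm1E.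
  by case: eqP => [<-|_]; lia.
have -> : (z - y = z - (y + U_(a)) + U_(a))%MM.
  apply/mnmP => b; rewrite !(mnmDE, mnmBE) mnm1E.
  by case: eqP => [<-|_]; lia.
by rewrite mdegD mdeg1 addn1 addnS.
Qed.

Lemma mnm_add1_sub m a : (0 < m a)%N -> exists m', m = (m' + U_(a))%MM.
Proof.
move=> ma; exists (m - U_(a))%MM; apply/mnmP => b.
by rewrite mnmDE mnmBE mnm1E; case: eqP => [<-|_]; lia.
Qed.

Lemma mnm_neq_ex y z : y != z -> exists a, y a != z a.
Proof.
move=> neq; apply/existsP; apply: contraT; rewrite negb_exists => /forallP eqyz.
by case/eqP: neq; apply/mnmP => a; have /negPn/eqP := eqyz a.
Qed.

End Multinomials.

(** * Integral flows on the quiver and their divergence *)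

Section Divergence.

Variables (nv na : nat) (src tgt : 'I_na -> 'I_nv).
Implicit Types (m y z : 'X_{1..na}) (a : 'I_na) (u v t x : 'I_nv).

Definition divergence m v : int :=
  \sum_(a < na | tgt a == v) (m a)%:Z - \sum_(a < na | src a == v) (m a)%:Z.

Lemma divergenceD m1 m2 v :
  divergence (m1 + m2)%MM v = divergence m1 v + divergence m2 v.
Proof.
rewrite /divergence.
under eq_bigr do rewrite mnmDE PoszD.
under [X in _ - X]eq_bigr do rewrite mnmDE PoszD.
rewrite !big_split /=; ring.
Qed.

Lemma divergence0 v : divergence 0%MM v = 0.
Proof. by rewrite /divergence !big1 ?subr0 // => a _; rewrite mnm0E. Qed.

Lemma divergence1 a v :
  divergence U_(a)%MM v = (tgt a == v)%:Z - (src a == v)%:Z.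
Proof.
have sum1 (P : pred 'I_na) : \sum_(b < na | P b) (U_(a)%MM b)%:Z = (P a)%:Z.
  case Pa: (P a); last first.
    rewrite big1 // => b Pb; rewrite mnm1E.
    by case: eqP => // ab; rewrite -ab Pa in Pb.
  rewrite (bigD1 a) //= mnm1E eqxx big1 ?addr0 // => b /andP[_ nba].
  by rewrite mnm1E eq_sym (negbTE nba).
by rewrite /divergence !sum1.
Qed.

Lemma divergence_sum (I : Type) (r : seq I) (F : I -> 'X_{1..na}) v :
  divergence (\sum_(i <- r) F i)%MM v = \sum_(i <- r) divergence (F i) v.
Proof.
elim: r => [|i r IH]; first by rewrite !big_nil divergence0.
by rewrite !big_cons divergenceD IH.
Qed.

Lemma divergence_lt_arrow y z u : divergence y u < divergence z u ->
  exists a, (tgt a = u /\ (y a < z a)%N) \/ (src a = u /\ (z a < y a)%N).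
Proof.
move=> lt_yz.
have [|] := boolP [exists a, ((tgt a == u) && (y a < z a)%N)
                          || ((src a == u) && (z a < y a)%N)].
  by case/existsP => a /orP[] /andP[/eqP au lt]; exists a; [left | right].
rewrite negb_exists => /forallP none.
suff: divergence z u <= divergence y u by rewrite leNgt lt_yz.
rewrite /divergence lerB //; apply: ler_sum => a /eqP au.
  by move: (none a); rewrite au eqxx /= negb_or -leqNgt => /andP[].
by move: (none a); rewrite au eqxx /= negb_or -leqNgt => /andP[].
Qed.

(** A trail is peeled off from [v]: an arrow entering the current vertex goes to [d'], an arrow
    leaving it goes to [d], and the trail continues at the other end of the arrow. Either choice
    restores the form of the hypothesis. *)
Lemma halving (H : 'X_{1..na}) (th : 'I_nv -> int) v t :
  (forall x, divergence H x = th x *+ 2 + (v == x)%:Z - (t == x)%:Z) ->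
  exists2 d, (exists d', H = (d + d')%MM) & forall x, divergence d x = th x.
Proof.
have [n] := ubnP (mdeg H); elim: n => // n IH in H th v t *.
move=> leHn divH.
have [H0|nzH] := eqVneq H 0%MM.
  exists 0%MM; first by exists 0%MM; rewrite addm0.
  move=> x; have := divH x; rewrite H0 !divergence0.
  (* By parity [th v *+ 2 + 1] cannot vanish, so [t = v] and hence [th = 0]. *)
  have := divH v; rewrite H0 divergence0 eqxx.
  have [<-|_] := eqVneq t v; last by lia.
  lia.
have [v' [t' [a [ma at_v' div']]]] : exists v' t' a,
   [/\ (0 < H a)%N, tgt a = v' \/ src a = v' &
    forall x, divergence H x = th x *+ 2 + (v' == x)%:Z - (t' == x)%:Z].
  (* A closed trail may restart at any arrow of [H]; otherwise the divergence at [v] is odd, so some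
     arrow of [H] meets [v]. *)
  have [vt|nvt] := eqVneq v t.
    have [a] := mnm_neq_ex nzH; rewrite mnm0E -lt0n => ma.
    exists (tgt a), (tgt a), a; split=> //; first by left.
    by move=> x; rewrite divH vt; lia.
  have dv : divergence H v = th v *+ 2 + 1.
    by rewrite divH eqxx (negbTE (_ : t != v)) ?subr0 // eq_sym.
  have [neg|pos] := ltP (divergence H v) (divergence 0%MM v).
    have [a [[_]|[av]]] := divergence_lt_arrow neg; rewrite mnm0E // => ma.
    by exists v, t, a; split=> //; right.
  have {}pos: divergence 0%MM v < divergence H v.
    by move: pos; rewrite divergence0 dv; lia.
  have [a [[av]|[_]]] := divergence_lt_arrow pos; rewrite mnm0E // => ma.
  by exists v, t, a; split=> //; left.
have [H' defH] := mnm_add1_sub ma.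
have ltH' : (mdeg H' < n)%N by move: leHn; rewrite defH mdegD mdeg1; lia.
case: at_v' => av'.
  have [|d [d' defH'] divd] := IH H' th (src a) t' ltH'.
    by move=> x; have := div' x; rewrite defH divergenceD divergence1 av'; lia.
  by exists d => //; exists (d' + U_(a))%MM; rewrite defH defH' addmA.
(* As [a] will be added to [d], the recursion aims at [th] minus the divergence of [U_(a)]. *)
have [|d [d' defH'] divd] :=
    IH H' (fun x => th x + (v' == x)%:Z - (tgt a == x)%:Z) (tgt a) t' ltH'.
  by move=> x; have := div' x; rewrite defH divergenceD divergence1 av'; lia.
exists (d + U_(a))%MM.
  by exists d'; rewrite defH defH' -!addmA [(d' + _)%MM]addmC.
by move=> x; rewrite divergenceD divergence1 divd av'; lia.
Qed.

(** Conservation makes every arrow that carries flow be followed by another one; by finiteness,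
    following them closes an oriented cycle. *)
Lemma circulation_eq0 m : acyclic_quiver src tgt ->
  (forall v, divergence m v = 0) -> m = 0%MM.
Proof.
move=> acyc div0; apply/mnmP => a0; rewrite mnm0E.
apply/eqP; rewrite -leqn0 leqNgt.
apply/negP => ma0.
have next a : exists b, (0 < m a)%N ==> (0 < m b)%N && (src b == tgt a).
  have [ma|_] := boolP (0 < m a)%N; last by exists a.
  have [/existsP //|] := boolP [exists b, (0 < m b)%N && (src b == tgt a)].
  rewrite negb_exists => /forallP none.
  have := div0 (tgt a); rewrite /divergence [X in _ - X]big1 => [|b /eqP sb].
    rewrite (bigD1 a) //= subr0.
    set S := \sum_(_ < na | _) _.
    have : 0 <= S by exact: sumr_ge0.
    move: S => S; lia.
  by have := none b; rewrite sb eqxx andbT; lia.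
have [f nextP] : exists f : 'I_na -> 'I_na,
    forall a, (0 < m a)%N -> (0 < m (f a))%N /\ src (f a) = tgt a.
  exists (fun a => xchoose (next a)) => a ma.
  by have /implyP/(_ ma)/andP[-> /eqP] := xchooseP (next a).
have miter i : (0 < m (iter i f a0))%N by elim: i => //= i /nextP[].
have [i [p loop]] : exists i p, iter p.+1 f (iter i f a0) = iter i f a0.
  have /trajectP[i lt_i loop] := looping_order f a0.
  exists i, (fingraph.order f a0 - i).-1; rewrite -iterD -[RHS]loop.
  congr (iter _ f a0); lia.
set b := iter i f a0 in loop.
have mb j : (0 < m (iter j f b))%N by rewrite /b -iterD.
have /negP := acyc (traject f b p.+1); apply.
rewrite /= last_traject; apply/andP; split.
  elim: p b mb {loop} => //= p IH b mb.
  have [_ ->] := nextP b (mb 0%N); rewrite eqxx /=.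
  by apply: IH => j; have := mb j.+1; rewrite iterSr.
by have [_ <-] := nextP _ (mb p); rewrite -iterS loop.
Qed.

End Divergence.

(** * Ideals generated in bounded degree *)

Section GeneratedIdeal.

Variables (N : nat) (K : {mpoly CC[N]} -> Prop) (d : nat).
Local Notation I := (in_ideal_gen_by_deg_le K d).

Lemma ideal_gen0 : I 0.
Proof. by exists [::]; split=> //; rewrite big_nil. Qed.

Lemma ideal_genD f g : I f -> I g -> I (f + g).
Proof.
move=> [s [sK ->]] [t [tK ->]]; exists (s ++ t); split; last by rewrite big_cat.
by move=> hg; rewrite mem_cat => /orP[/sK | /tK].
Qed.

Lemma ideal_genM h f : I f -> I (h * f).
Proof.
move=> [s [sK ->]]; exists [seq (h * hg.1, hg.2) | hg <- s]; split.
  by move=> _ /mapP[hg /sK hgK ->].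
by rewrite big_map mulr_sumr; apply: eq_bigr => hg _; rewrite mulrA.
Qed.

Lemma mem_ideal_gen f : K f -> (msize f <= d.+1)%N -> I f.
Proof.
move=> Kf df; exists [:: (1, f)]; split; last by rewrite big_seq1 mul1r.
by move=> hg; rewrite inE => /eqP ->.
Qed.

End GeneratedIdeal.

(** * Reduction of the kernel to binomials *)

Section Binomials.

Variables (na N : nat) (e : 'I_N -> 'X_{1..na}).
Implicit Types (s t : seq 'I_N) (m : 'X_{1..N}).

Local Notation phi := (quiver_phi e).
Local Notation I := (in_ideal_gen_by_deg_le (fun g => phi g = 0) 3).

(** A list of indices stands for a monomial of the source ring, with exponent [word s] and with
    image of exponent [weight s]; its entries are the summands of a decomposition. *)
Definition word s : 'X_{1..N} := (\sum_(i <- s) U_(i))%MM.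
Definition weight s : 'X_{1..na} := (\sum_(i <- s) e i)%MM.

Lemma word_cat s t : word (s ++ t) = (word s + word t)%MM.
Proof. by rewrite /word big_cat. Qed.

Lemma weight_cons i s : weight (i :: s) = (e i + weight s)%MM.
Proof. by rewrite /weight big_cons. Qed.

Lemma word_perm s t : perm_eq s t -> word s = word t.
Proof. exact: perm_big. Qed.

Lemma weight_perm s t : perm_eq s t -> weight s = weight t.
Proof. exact: perm_big. Qed.

Lemma mdeg_word s : mdeg (word s) = size s.
Proof.
by rewrite /word mdeg_sum -sum1_size; apply: eq_bigr => i _; rewrite mdeg1.
Qed.

Lemma wordP m : exists s, m = word s.
Proof.
exists (flatten [seq nseq (m i) i | i <- enum 'I_N]).
rewrite /word big_flatten big_map big_enum {1}(multinomUE_id m).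
by apply: eq_bigr => i _; rewrite big_nseq /= -Monoid.iteropE.
Qed.

Lemma phi_word s : phi 'X_[word s] = 'X_[weight s].
Proof.
rewrite /word /weight /quiver_phi; elim: s => [|i s IH].
  by rewrite !big_nil !mpolyX0 rmorph1.
by rewrite !big_cons !mpolyXD rmorphM /= IH comp_mpolyXU -tnth_nth tnth_mktuple.
Qed.

Definition equiv s t := I ('X_[word s] - 'X_[word t]).

Lemma equiv_perm s t : perm_eq s t -> equiv s t.
Proof. by move=> st; rewrite /equiv (word_perm st) subrr; apply: ideal_gen0. Qed.

Lemma equiv_trans s t r : equiv s t -> equiv t r -> equiv s r.
Proof. by move=> st tr; have := ideal_genD st tr; rewrite addrA subrK. Qed.

Lemma equiv_sym s t : equiv s t -> equiv t s.
Proof. by move=> /(ideal_genM (-1)); rewrite mulN1r opprB. Qed.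

Lemma equiv_catr s t r : equiv s t -> equiv (s ++ r) (t ++ r).
Proof.
move=> /(ideal_genM 'X_[word r]).
by rewrite mulrBr -!mpolyXD ![(word r + _)%MM]addmC -!word_cat.
Qed.

(** The binomial of [s] and [t] is itself an allowed generator, and [r] is a common factor. *)
Lemma equiv_move s t r : (size s <= 3)%N -> (size t <= 3)%N ->
  weight s = weight t -> equiv (s ++ r) (t ++ r).
Proof.
move=> s3 t3 st; apply: equiv_catr; apply: mem_ideal_gen.
  by rewrite /quiver_phi raddfB /= -!/(phi _) !phi_word st subrr.
rewrite (leq_trans (msizeD_le _ _)) // msizeN !msizeX !mdeg_word.
by rewrite geq_max !ltnS s3.
Qed.

Lemma equiv_cons i s t : equiv s t -> equiv (i :: s) (i :: t).
Proof.
move=> st; apply: (equiv_trans (t := s ++ [:: i])).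
  by apply: equiv_perm; rewrite perm_sym perm_catC.
apply: (equiv_trans (equiv_catr [:: i] st)).
by apply: equiv_perm; rewrite perm_catC.
Qed.

(* As [phi f = 0], a monomial of [f] shares its weight with another one, so
   subtracting a multiple of their difference removes it from the support. *)
Lemma kernel_binomials :
  (forall s t, weight s = weight t -> equiv s t) ->
  forall f, phi f = 0 -> I f.
Proof.
move=> eqW f; have [n] := ubnP (size (msupp f)); elim: n => // n IH in f *.
move=> fn phif.
have [->|nzf] := eqVneq f 0; first exact: ideal_gen0.
have [m mf] : exists m, m \in msupp f.
  by exists (mlead f); apply: mlead_supp.
have [s ms] := wordP m.
have [m' m'f /andP[m'm /eqP phim']] :
    exists2 m', m' \in msupp f & (m' != m) && (phi 'X_[m'] == phi 'X_[m]).
  apply/hasP; apply: contraT => /hasPn none.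
  have := congr1 (mcoeff (weight s)) phif.
  rewrite /quiver_phi comp_mpolyEX raddf_sum /= mcoeff0 (bigD1_seq m) //=.
  rewrite big_seq_cond big1 => [|m1 /andP[m1f m1m]].
    rewrite mcoeffZ -/(phi _) ms phi_word mcoeffX eqxx mulr1 addr0 => /eqP.
    by rewrite mcoeff_eq0 -ms mf.
  have [s1 def1] := wordP m1.
  have /negbTE neq : weight s1 != weight s.
    apply: contra (none _ m1f) => /eqP eqs.
    by rewrite m1m /= def1 ms !phi_word eqs.
  by rewrite mcoeffZ -/(phi _) def1 phi_word mcoeffX neq mulr0.
have [s' ms'] := wordP m'.
have ss' : weight s = weight s'.
  move: phim'; rewrite ms ms' !phi_word => /(congr1 (@msupp _ _)).
  by rewrite !msuppX => -[].
have bin : I ('X_[m] - 'X_[m']) by rewrite ms ms'; apply: eqW.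
rewrite -[f](subrK (f@_m *: ('X_[m] - 'X_[m']))).
set g := f - _; apply: ideal_genD; last first.
  by rewrite -mul_mpolyC; apply: ideal_genM.
apply: IH; last first.
  rewrite /quiver_phi raddfB /= linearZ raddfB /= -!/(phi _) phif phim'.
  by rewrite subrr scaler0 subr0.
(* No new monomial appears, since [m'] already lies in the support of [f]. *)
have sub : {subset msupp g <= rem m (msupp f)}.
  move=> m1; rewrite mem_rem_uniq ?msupp_uniq // inE !mcoeff_msupp.
  rewrite !mcoeffB mcoeffZ mcoeffB !mcoeffX.
  have [->|nm1m] := eqVneq m1 m.
    by rewrite (negbTE m'm) subr0 mulr1 subrr eqxx.
  rewrite sub0r /=; apply: contra => /eqP f0.
  have [eqm|_] := eqVneq m' m1; last by rewrite f0 oppr0 mulr0 subr0.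
  by move: m'f; rewrite eqm mcoeff_msupp f0 eqxx.
have := uniq_leq_size (msupp_uniq g) sub.
rewrite size_rem // => le; move: fn.
case: (msupp f) mf le => //= _ f' _ le.
by rewrite ltnS; apply: leq_ltn_trans.
Qed.

End Binomials.

(** * Connecting decompositions into lattice points *)

Section Walk.

Variables (nv na N : nat) (src tgt : 'I_na -> 'I_nv) (theta : 'I_nv -> int).
Variable e : 'I_N -> 'X_{1..na}.
Hypothesis e_flow : forall i, quiver_lattice_point src tgt theta (e i).
Hypothesis flow_e : forall m,
  quiver_lattice_point src tgt theta m -> exists i, e i = m.

Local Notation div := (divergence src tgt).
Local Notation "s ~ t" := (equiv e s t) (at level 70).
Implicit Types (a : 'I_na) (u v x : 'I_nv) (i j : 'I_N) (s t r : seq 'I_N).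

Lemma div_e i v : div (e i) v = theta v.
Proof. exact/esym/e_flow. Qed.

Lemma index_of_flow (m : 'X_{1..na}) :
  (forall v, div m v = theta v) -> exists i, e i = m.
Proof. by move=> divm; apply: flow_e => v; apply/esym/divm. Qed.

Lemma div_weight s v : div (weight e s) v = theta v *+ size s.
Proof.
rewrite divergence_sum (eq_bigr (fun=> theta v)) => [|i _]; last exact: div_e.
by rewrite big_const_seq count_predT iter_addr addr0.
Qed.

(** Halving leaves a remainder [w] that carries the whole defect, as [e i] has none. *)
Lemma split_defect (m : 'X_{1..na}) u v :
  (forall x, div m x = theta x *+ 2 + (u == x)%:Z - (v == x)%:Z) ->
  exists i w, m = (e i + w)%MM.
Proof.
move=> /halving[d [w ->] divd].
by have [i <-] : exists i, e i = d; [apply: index_of_flow | exists i, w].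
Qed.

Lemma split_flow2 (m : 'X_{1..na}) u :
  (forall x, div m x = theta x *+ 2) -> exists i j, m = (e i + e j)%MM.
Proof.
move=> divm; have [|i [w def]] := @split_defect m u u.
  by move=> x; rewrite divm addrK.
have [|j ew] := @index_of_flow w; last by exists i, j; rewrite ew.
by move=> x; have := divm x; rewrite def divergenceD div_e; lia.
Qed.

(* The defects of [z] and [w] at [u] and [v] cancel in [z + w], which splits
   into two flows. Moving [z] one arrow closer to [e j] moves the defect [u]
   along this arrow, and affects at most one flow besides [z] and [w]. *)
Lemma walk n j r (z w : 'X_{1..na}) u v :
  (mnm_dist z (e j) < n)%N ->
  (forall x, div z x = theta x + (u == x)%:Z - (v == x)%:Z) ->
  (forall x, div w x = theta x - (u == x)%:Z + (v == x)%:Z) ->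
  (forall a, (e j a <= z a + w a + weight e r a)%N) ->
  exists2 r',
    size r' = (size r).+1 /\ weight e (j :: r') = (z + w + weight e r)%MM
    & forall i1 i2, (e i1 + e i2)%MM = (z + w)%MM -> i1 :: i2 :: r ~ j :: r'.
Proof.
elim: n => // n IH in r z w u v *; move=> dist divz divw le_j.
have [zj|nzj] := eqVneq z (e j).
  have [|i ei] := @index_of_flow w.
    by move=> x; have := divz x; have := divw x; rewrite zj div_e; lia.
  exists (i :: r); first by rewrite !weight_cons ei zj addmA.
  move=> i1 i2 ei12; apply: (@equiv_move _ _ _ [:: i1; i2] [:: j; i]) => //.
  by rewrite /weight !big_cons big_nil !addm0 ei12 ei zj.
have [u' [v' [a [step divz' divw']]]] : exists u' v' a,
  [/\ (tgt a = u' /\ (e j a < z a)%N) \/ (src a = u' /\ (z a < e j a)%N),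
      forall x, div z x = theta x + (u' == x)%:Z - (v' == x)%:Z &
      forall x, div w x = theta x - (u' == x)%:Z + (v' == x)%:Z].
  (* A genuine defect at [u] forces [z] and [e j] to differ suitably on an arrow there. Without
     defect, source and sink are both put at an end of any arrow where they differ. *)
  have [uv|nuv] := eqVneq u v; last first.
    have [|a step] := @divergence_lt_arrow _ _ src tgt (e j) z u.
      by rewrite div_e divz eqxx eq_sym (negbTE nuv); lia.
    by exists u, v, a.
  have [a neq] := mnm_neq_ex nzj.
  have [lt|gt|eq] := ltngtP (z a) (e j a).
  - by exists (src a), (src a), a; split=> [|x|x];
       [right | rewrite divz uv; lia | rewrite divw uv; lia].
  - by exists (tgt a), (tgt a), a; split=> [|x|x];
       [left | rewrite divz uv; lia | rewrite divw uv; lia].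
  - by rewrite eq eqxx in neq.
move: divz divw => _ _; case: step => [[au lt]|[au lt]].
  have [z' defz] : exists z', z = (z' + U_(a))%MM by apply: mnm_add1_sub; lia.
  have zw : (z' + (w + U_(a)) = z + w)%MM.
    by rewrite defz -[RHS]addmA [(w + _)%MM]addmC.
  have [|x|x|b|r' sz' eq'] := IH r z' (w + U_(a))%MM (src a) v'.
  + move: dist lt; rewrite defz mnmDE mnm1E eqxx addn1 ltnS => + le.
    by rewrite mnm_distUl.
  + by have := divz' x; rewrite defz divergenceD divergence1 au; lia.
  + by rewrite divergenceD divergence1 divw' au; lia.
  + by rewrite -mnmDE zw mnmDE.
  by exists r'; rewrite -zw.
have dist' : (mnm_dist (z + U_(a))%MM (e j) < n)%N.
  by rewrite -ltnS -mnm_distUr.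
have divz2 x : div (z + U_(a))%MM x = theta x + (tgt a == x)%:Z - (v' == x)%:Z.
  by rewrite divergenceD divergence1 divz' au; lia.
have [wa|w0] := posnP (w a); last first.
  have [w' defw] := mnm_add1_sub w0.
  have zw : (z + U_(a) + w' = z + w)%MM.
    by rewrite defw -addmA [(U_(a) + _)%MM]addmC.
  have [//|//|x|b|r' sz' eq'] := IH r (z + U_(a))%MM w' (tgt a) v'.
  + by have := divw' x; rewrite defw divergenceD divergence1 au; lia.
  + by rewrite -mnmDE zw mnmDE.
  by exists r'; rewrite -zw.
(* Neither [z] nor [w] can supply the missing arrow, so by [le_j] some summand in [r] contains
   it. *)
have [d dr da] : exists2 d, d \in r & (0 < e d a)%N.
  apply/hasP; apply: contraT => /hasPn none.
  have := le_j a; rewrite wa /weight mnm_sumE big_seq big1; first by lia.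
  by move=> d /none; lia.
have perm_r := perm_to_rem dr; set r0 := rem d r in perm_r.
have weight_r : weight e r = (e d + weight e r0)%MM.
  by rewrite (weight_perm _ perm_r) weight_cons.
have [h defd] := mnm_add1_sub da.
(* Taking [a] from [d] cancels the defect of [w] at [u'] and leaves one at [tgt a], so [w'] is
   opposite to [z + U_(a)]. *)
have [|d' [w' defw]] := @split_defect (w + h)%MM v' (tgt a).
  move=> x; have := div_e d x.
  rewrite defd !divergenceD divergence1 divw' au; lia.
have zw : (z + U_(a) + w' + e d' = z + w + e d)%MM.
  by apply/mnmP => b; have := congr1 (fun m : 'X_{1..na} => m b) defw;
     rewrite defd !mnmDE /=; lia.
have divw2 x : div w' x = theta x - (tgt a == x)%:Z + (v' == x)%:Z.
  have := congr1 (div^~ x) defw; have := div_e d x.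
  by rewrite /= defd !divergenceD div_e divergence1 divw' au; lia.
have [//|//|//|b|r' [sz' wt'] eq'] :=
    IH (d' :: r0) (z + U_(a))%MM w' (tgt a) v'.
  rewrite weight_cons -!mnmDE addmA zw.
  by have := le_j b; rewrite weight_r -!mnmDE addmA.
(* Any splitting of the new sum will do: replacing [i1, i2, d] by [k1, k2, d'] is the move on three
   summands. *)
have [|k1 [k2 def_k]] := @split_flow2 (z + U_(a) + w')%MM u.
  by move=> x; rewrite divergenceD divz2 divw2; lia.
exists r'.
  rewrite sz' wt' weight_r weight_cons !addmA zw; split=> //.
  by rewrite (perm_size perm_r).
move=> i1 i2 ei12; apply: equiv_trans (eq' k1 k2 (esym def_k)).
apply: (@equiv_trans _ _ _ _ [:: i1, i2, d & r0]).
  by apply: equiv_perm; rewrite !perm_cons.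
apply: (@equiv_move _ _ _ [:: i1; i2; d] [:: k1; k2; d']) => //.
by rewrite /weight !big_cons big_nil !addm0 !addmA ei12 -def_k zw.
Qed.

Lemma equiv_same_size s t : injective e -> size s = size t ->
  weight e s = weight e t -> s ~ t.
Proof.
move=> e_inj; elim: t => [|j t IH] in s *.
  by move=> /size0nil -> _; apply: equiv_perm.
case: s => // i1 s [sz] wt.
have [eij|neij] := eqVneq (e i1) (e j).
  rewrite (e_inj _ _ eij); apply: equiv_cons; apply: IH => //.
  by apply: (@addmI _ (e i1)); rewrite {2}eij -!weight_cons.
case: s sz wt => [|i2 r] sz wt.
  case: t sz wt {IH} => // _ /eqP.
  by rewrite /weight !big_seq1 (negbTE neij).
(* The walk starts without defect; [a] merely provides a vertex to serve as both source and sink. *)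
have [a _] := mnm_neq_ex neij.
have [|x|x|b|r' [sz' wt'] eq'] :=
  @walk (mnm_dist (e i1) (e j)).+1 j r (e i1) (e i2) (src a) (src a).
- exact: ltnSn.
- by rewrite div_e addrK.
- by rewrite div_e subrK.
- by rewrite -!mnmDE -addmA -!weight_cons wt weight_cons mnmDE leq_addr.
apply: equiv_trans (eq' i1 i2 erefl) _; apply: equiv_cons; apply: IH.
  by rewrite sz' -sz.
by apply: (@addmI _ (e j)); rewrite -!weight_cons wt' -wt !weight_cons addmA.
Qed.

Lemma equiv_weight s t : acyclic_quiver src tgt -> injective e ->
  weight e s = weight e t -> s ~ t.
Proof.
move=> acyc e_inj wt.
have [/(equiv_same_size e_inj)|nsz] := eqVneq (size s) (size t); first exact.
(* The total divergence at [v] is [theta v] times the number of summands, and these numbers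
   differ. *)
have theta0 v : theta v = 0.
  have /eqP := congr1 (div^~ v) wt; rewrite /= !div_weight.
  rewrite -[_ *+ size s]mulr_natr -[_ *+ size t]mulr_natr.
  rewrite -subr_eq0 -mulrBr mulf_eq0 subr_eq0 eqr_nat (negbTE nsz) orbF.
  by move=> /eqP.
have e0 i : e i = 0%MM.
  by apply: (circulation_eq0 acyc) => v; rewrite div_e.
have nil r : r ~ [::].
  elim: r => [|i r IH]; first exact: equiv_perm.
  apply: equiv_trans IH; apply: (@equiv_move _ _ _ [:: i] [::]) => //.
  by rewrite /weight big_seq1 big_nil e0.
exact: equiv_trans (nil s) (equiv_sym (nil t)).
Qed.

End Walk.

Theorem theorem9p3 (nv na : nat) (src tgt : 'I_na -> 'I_nv)
  (theta : 'I_nv -> int) (N : nat) (e : 'I_N -> arrow_vec na) :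
  acyclic_quiver src tgt ->
  injective e ->
  (forall i, quiver_lattice_point src tgt theta (e i)) ->
  (forall m, quiver_lattice_point src tgt theta m -> exists i, e i = m) ->
  forall f : {mpoly CC[N]},
    quiver_phi e f = 0 ->
    in_ideal_gen_by_deg_le (fun g => quiver_phi e g = 0) 3 f.
Proof.
move=> acyc e_inj e_flow flow_e f.
by apply: kernel_binomials => s t; apply: (equiv_weight e_flow flow_e).
Qed.
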